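(* Let $X$ be a Banach space with a separable dual, with an unconditional asymptotic structure and with $S_Z(X)>\omega$. Then $\ell_1^n$ is in the $n$-th asymptotic structure of $X$ for every $n\ge1$.
   Context: Szlenk index. For a weak$^*$-compact $K\subset X^*$ and $\varepsilon>0$, let $s_\varepsilon(K)$ be $K$ minus the union of all (relatively) weak$^*$-open subsets $V$ of $K$ with $\operatorname{diam}V\le\varepsilon$. Put $s^1_\varepsilon(K)=s_\varepsilon(K)$, $s^{\alpha+1}_\varepsilon(K)=s_\varepsilon(s^\alpha_\varepsilon(K))$, and $s^\alpha_\varepsilon(K)=\bigcap_{\beta<\alpha}s^\beta_\varepsilon(K)$ for limit $\alpha$. Let $S_Z(K,\varepsilon)$ be the least $\alpha$ with $s^\alpha_\varepsilon(K)=\emptyset$ if it exists and $\infty$ otherwise ($\infty$ is larger than every ordinal), and $S_Z(X)=\sup_{\varepsilon>0}S_Z(B_{X^*},\varepsilon)$, $B_{X^*}$ being the closed unit ball of $X^*$. $\omega$ is the first infinite ordinal. Let $\mathrm{cof}(X)$ be the set of closed subspaces of $X$ of finite codimension; $S_Y$ denotes the unit sphere of $Y$. $X$ has an unconditional asymptotic structure if there is $C\ge1$ such that for every $n\ge1$: $\exists X_1\in\mathrm{cof}(X)\ \forall x_1\in S_{X_1}\ \cdots\ \exists X_n\in\mathrm{cof}(X)\ \forall x_n\in S_{X_n}$: $(x_i)_{i=1}^n$ is $C$-unconditional, i.e. $\|\sum\epsilon_ia_ix_i\|\le C\|\sum a_ix_i\|$ for all scalars $a_i$ and signs $\epsilon_i$.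 An $n$-dimensional space $E$ with normalized basis $(e_i)_{i=1}^n$ is in the $n$-th asymptotic structure of $X$ if for all $\varepsilon>0$: $\forall X_1\in\mathrm{cof}(X)\ \exists x_1\in S_{X_1}\ \cdots\ \forall X_n\in\mathrm{cof}(X)\ \exists x_n\in S_{X_n}$: $(x_i)_{i=1}^n$ is $(1+\varepsilon)$-equivalent to $(e_i)_{i=1}^n$. Here $(x_i)$ is $C$-equivalent to $(e_i)$ if there are $A,B>0$ with $AB\le C$ and $\frac1A\|\sum a_ie_i\|\le\|\sum a_ix_i\|\le B\|\sum a_ie_i\|$ for all scalars $a_i$. $\ell_1^n$ is taken with its unit vector basis. *)

(* Defs.v *)
From HB Require Import structures.
From mathcomp Require Import all_boot all_order all_algebra.
From mathcomp Require Import all_classical all_reals all_analysis.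
Set Implicit Arguments.
Unset Strict Implicit.
Unset Printing Implicit Defensive.
Import Order.TTheory GRing.Theory Num.Theory.
Import numFieldNormedType.Exports.
Local Open Scope classical_set_scope.
Local Open Scope ring_scope.

(* Ordinals are presented by well-founded trees: [OSup f] is the least ordinal
   strictly above all the [f i].  Distinct trees may present the same ordinal;
   [ole] and [olt] compare the presented ordinals. *)
Inductive Ord : Type := OSup (I : Type) (f : I -> Ord).

Fixpoint ole (a b : Ord) {struct a} : Prop :=
  match a with
  | OSup T f => forall i, match b with OSup J g => exists j, ole (f i) (g j) end
  end.

Definition olt (a b : Ord) : Prop :=
  match b with OSup J g => exists j, ole a (g j) end.

Definition O0 : Ord := OSup (fun i : void => match i with end).
Definition OS (a : Ord) : Ord := OSup (fun _ : unit => a).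
Definition Omega : Ord := OSup (fun n : nat => iter n OS O0).

Definition olimit (a : Ord) : Prop :=
  olt O0 a /\ forall b, olt b a -> olt (OS b) a.

(* Ordinals together with the symbol infinity, encoded as [None]. *)
Definition xOrd : Type := option Ord.

Definition xle (a b : xOrd) : Prop :=
  match a, b with
  | _, None => True
  | None, Some _ => False
  | Some a, Some b => ole a b
  end.

Definition xlt (a b : xOrd) : Prop :=
  match a, b with
  | None, _ => False
  | Some _, None => True
  | Some a, Some b => olt a b
  end.

(* The least ordinal with property [P], infinity if there is none. *)
Definition oleast (P : Ord -> Prop) : xOrd :=
  match pselect (exists a, P a /\ forall b, P b -> ole a b) with
  | left h => Some (projT1 (cid h))
  | right _ => None
  end.

Section Dual.
Variables (R : realType) (X : normedModType R).

Definition dual : set (X -> R) := [set f : X -> R | scalar f /\ continuous f].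

(* Meaningful for [f] in [dual] only: [sup] of an unbounded set is a junk value. *)
Definition dual_norm (f : X -> R) : R := sup [set `|f x| | x in [set x | `|x| <= 1]].

Definition dual_ball : set (X -> R) := [set f | dual f /\ dual_norm f <= 1].

Definition dual_diam (V : set (X -> R)) : \bar R :=
  ereal_sup [set (dual_norm (f \- g))%:E | f in V & g in V].

(* The weak* topology is the one induced on [dual] by pointwise convergence. *)
Definition weak_star_open_in (K V : set (X -> R)) : Prop :=
  exists2 U : set {ptws X -> R}, open U & V = K `&` U.

Definition szlenk_step (e : R) (K : set (X -> R)) : set (X -> R) :=
  K `\` \bigcup_(V in [set V | weak_star_open_in K V /\ (dual_diam V <= e%:E)%E]) V.

(* One clause gives the usual three: see [szlenk_derivation0],
   [szlenk_derivationS] and [szlenk_derivation_lim]. *)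
Fixpoint szlenk_derivation (e : R) (K : set (X -> R)) (a : Ord) : set (X -> R) :=
  match a with
  | OSup T f => K `&` \bigcap_(i : T) szlenk_step e (szlenk_derivation e K (f i))
  end.

Definition szlenk_index_at (K : set (X -> R)) (e : R) : xOrd :=
  oleast (fun a => szlenk_derivation e K a = set0).

(* The supremum, i.e. the least upper bound. *)
Definition szlenk_index : xOrd :=
  oleast (fun a => forall e : R, 0 < e -> xle (szlenk_index_at dual_ball e) (Some a)).

Definition separable_dual : Prop :=
  exists2 D : set (X -> R), countable D & D `<=` dual /\
    forall f, dual f -> forall e : R, 0 < e ->
      exists2 g, D g & dual_norm (f \- g) < e.

End Dual.

Section Asymptotic.
Variables (R : realType) (X : normedModType R).

Definition cof (Y : set X) : Prop :=
  [/\ closed Y,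
      Y 0 /\ (forall (a : R) x y, Y x -> Y y -> Y (a *: x + y)) &
      exists m (v : 'I_m -> X), forall x, exists c : 'I_m -> R,
        Y (x - \sum_(i < m) c i *: v i)].

Definition sphere (Y : set X) : set X := [set x | Y x /\ `|x| = 1].

(* exists X_1 forall x_1 ... exists X_n forall x_n, P [:: x_1; ...; x_n] *)
Fixpoint ex_cof_all (n : nat) (P : seq X -> Prop) : Prop :=
  if n is m.+1 then
    exists2 Y, cof Y & forall x, sphere Y x -> ex_cof_all m (fun s => P (x :: s))
  else P [::].

(* forall X_1 exists x_1 ... forall X_n exists x_n, P [:: x_1; ...; x_n] *)
Fixpoint all_cof_ex (n : nat) (P : seq X -> Prop) : Prop :=
  if n is m.+1 then
    forall Y, cof Y -> exists2 x, sphere Y x & all_cof_ex m (fun s => P (x :: s))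
  else P [::].

Definition unconditional (n : nat) (C : R) (s : seq X) : Prop :=
  forall (a : 'I_n -> R) (eps : 'I_n -> bool),
    `|\sum_(i < n) ((-1) ^+ eps i * a i) *: s`_i| <= C * `|\sum_(i < n) a i *: s`_i|.

Definition unconditional_asymptotic_structure : Prop :=
  exists2 C : R, 1 <= C &
    forall n, (1 <= n)%N -> ex_cof_all n (unconditional n C).

Definition normalized_basis (E : normedModType R) (n : nat) (e : 'I_n -> E) : Prop :=
  [/\ forall v, exists a : 'I_n -> R, v = \sum_(i < n) a i *: e i,
      forall a : 'I_n -> R, \sum_(i < n) a i *: e i = 0 -> forall i, a i = 0 &
      forall i, `|e i| = 1].

Definition equivalent_to (E : normedModType R) (n : nat) (e : 'I_n -> E)
    (C : R) (s : seq X) : Prop :=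
  exists A B : R, [/\ 0 < A, 0 < B, A * B <= C &
    forall a : 'I_n -> R,
      A^-1 * `|\sum_(i < n) a i *: e i| <= `|\sum_(i < n) a i *: s`_i|
        <= B * `|\sum_(i < n) a i *: e i|].

Definition in_asymptotic_structure (E : normedModType R) (n : nat)
    (e : 'I_n -> E) : Prop :=
  normalized_basis e /\
  forall eps : R, 0 < eps -> all_cof_ex n (equivalent_to e (1 + eps)).

End Asymptotic.
Arguments in_asymptotic_structure {R} X {E n} e.

(* A type of its own, since row vectors already carry the max norm. *)
Definition ell1 (R : realType) (n : nat) : Type := 'rV[R]_n.

Section Ell1.
Variables (R : realType) (n : nat).

HB.instance Definition _ := GRing.Lmodule.copy (ell1 R n) 'rV[R]_n.

Definition ell1_norm (x : ell1 R n) : R :=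
  \sum_(i < n) `|(x : 'rV[R]_n) ord0 i|.

Lemma ell1_normD x y : ell1_norm (x + y) <= ell1_norm x + ell1_norm y.
Proof.
by rewrite /ell1_norm -big_split /= ler_sum// => i _; rewrite mxE ler_normD.
Qed.

Lemma ell1_normZ (l : R) x : ell1_norm (l *: x) = `|l| * ell1_norm x.
Proof.
by rewrite /ell1_norm mulr_sumr; apply: eq_bigr => i _; rewrite mxE normrM.
Qed.

Lemma ell1_norm_eq0 x : ell1_norm x = 0 -> x = 0.
Proof.
move=> /eqP; rewrite psumr_eq0// => /allP x0; apply/rowP => i.
by have /= := x0 i (mem_index_enum i); rewrite normr_eq0 mxE => /eqP.
Qed.

HB.instance Definition _ := Lmodule_isNormed.Build R (ell1 R n)
  ell1_normD ell1_normZ ell1_norm_eq0.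

Definition ell1_basis (i : 'I_n) : ell1 R n := delta_mx ord0 i.

Lemma ell1_normE (x : ell1 R n) : `|x| = \sum_(i < n) `|(x : 'rV[R]_n) ord0 i|.
Proof. by []. Qed.

End Ell1.

Section OrdTheory.

Lemma ole_refl a : ole a a.
Proof. by elim: a => I f IH /= i; exists i. Qed.

Lemma ole_trans a b c : ole a b -> ole b c -> ole a c.
Proof.
elim: a b c => I f IH [J g] [K h] /= ab bc i.
by have [j fg] := ab i; have [k gh] := bc j; exists k; apply: IH fg gh.
Qed.

Lemma oleVlt a b : ole a b \/ olt b a.
Proof.
elim: a b => I f IH b; have [h|/existsNP[i h]] := pselect (forall i, olt (f i) b).
  by left; case: b h.
right; exists i; case: b h => J g /= h j.
have [|//] := IH i (g j); move=> fg; case: h; by exists j.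
Qed.

Lemma oltW a b : olt a b -> ole a b.
Proof.
elim: a b => I f IH [J g] /= [j fg] i.
exists j; case: (g j) fg => K h /(_ i)[k fh]; exact: (IH i (OSup h) (ex_intro _ k fh)).
Qed.

Lemma olt_le_trans a b c : olt a b -> ole b c -> olt a c.
Proof.
case: b c => J g [K h] /= [j aj] /(_ j)[k jk].
by exists k; exact: ole_trans aj jk.
Qed.

Lemma ole_lt_trans a b c : ole a b -> olt b c -> olt a c.
Proof. by case: c => K h ab /= [k bk]; exists k; exact: ole_trans ab bk. Qed.

Lemma olt_irr a : ~ olt a a.
Proof.
elim: a => I f IH /= [i] fi; apply: (IH i).
by apply: (@olt_le_trans _ (OSup f)) fi; exists i; exact: ole_refl.
Qed.

Lemma ole_gtF a b : ole a b -> ~ olt b a.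
Proof. by move=> ab ba; exact: (olt_irr (ole_lt_trans ab ba)). Qed.

(* Every nonempty class of ordinals has a least element, so that [oleast]
   takes the value infinity only on the empty class. *)
Lemma ex_oleast (P : Ord -> Prop) a :
  P a -> exists b, P b /\ forall c, P c -> ole b c.
Proof.
suff H b : ole b a -> P b -> exists b, P b /\ forall c, P c -> ole b c.
  by apply: H; exact: ole_refl.
elim: a b => I f IH b ba Pb.
have [h|/existsNP[c /not_implyP[Pc bc]]] := pselect (forall c, P c -> ole b c).
  by exists b.
have [//|cb] := oleVlt b c.
have /= [i cfi] := olt_le_trans cb ba.
exact: IH cfi Pc.
Qed.

Lemma oleast_some (P : Ord -> Prop) a :
  oleast P = Some a -> P a /\ forall b, P b -> ole a b.
Proof. by rewrite /oleast; case: pselect => // h [<-]; case: cid. Qed.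

Lemma oleast_none (P : Ord -> Prop) : oleast P = None <-> forall a, ~ P a.
Proof.
rewrite /oleast; case: pselect => [[a [Pa aP]]|nh]; split=> // h.
- by case: (h a).
- by move=> a Pa; case: nh; exact: ex_oleast Pa.
Qed.

End OrdTheory.

Section DerivationTheory.
Variables (R : realType) (X : normedModType R) (e : R) (K : set (X -> R)).
Local Notation s := (szlenk_derivation e K).

Lemma dual_diam_le (V : set (X -> R)) :
  (dual_diam V <= e%:E)%E <-> forall f g, V f -> V g -> dual_norm (f \- g) <= e.
Proof.
split=> [h f g Vf Vg|h].
  by rewrite -lee_fin; apply: le_trans h; apply: ereal_sup_ubound; exists f => //; exists g.
by apply: ge_ereal_sup => _ [f Vf [g Vg <-]]; rewrite lee_fin; exact: h.
Qed.

Lemma szlenk_step_sub (A : set (X -> R)) : szlenk_step e A `<=` A.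
Proof. exact: subDsetl. Qed.

Lemma szlenk_stepS (A B : set (X -> R)) :
  A `<=` B -> szlenk_step e A `<=` szlenk_step e B.
Proof.
move=> AB f [Af nf]; split; first exact: AB.
move=> [V [[U oU VE] /dual_diam_le dV] Vf]; apply: nf; exists (A `&` U); last first.
  by split=> //; move: Vf; rewrite VE => -[].
split; first by exists U.
apply/dual_diam_le => g h [Ag Ug] [Ah Uh].
by apply: dV; rewrite VE; split => //; exact: AB.
Qed.

Lemma szlenk_derivation_anti a b : ole a b -> s b `<=` s a.
Proof.
elim: a b => I f IH [J g] ab x /= [Kx sx]; split => // i _.
by have [j fg] := ab i; apply: (szlenk_stepS (IH _ _ fg)); exact: sx.
Qed.

Lemma szlenk_derivation_lt a b : olt a b -> s b `<=` szlenk_step e (s a).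
Proof.
case: b => J g /= [j aj] x [_ /(_ j Logic.I)].
by apply: szlenk_stepS; exact: szlenk_derivation_anti.
Qed.

Lemma szlenk_derivation0 : s O0 = K.
Proof. by apply/seteqP; split=> [x []//|x Kx]; split=> // -[]. Qed.

Lemma szlenk_derivation_sub a : s a `<=` K.
Proof. by case: a => I f x []. Qed.

Lemma szlenk_derivationS a : s (OS a) = szlenk_step e (s a).
Proof.
apply/seteqP; split=> [x [_ /(_ tt Logic.I)]//|x sx]; split=> //.
by apply: (@szlenk_derivation_sub a); exact: szlenk_step_sub sx.
Qed.

Lemma szlenk_derivation_lim a :
  olimit a -> s a = \bigcap_(b in [set b | olt b a]) s b.
Proof.
move=> [a0 aS]; apply/seteqP; split=> [x sx b /= ba|x sx].
  exact: szlenk_step_sub (szlenk_derivation_lt ba sx).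
case: a a0 aS sx => I f a0 aS sx /=; split.
  by rewrite -szlenk_derivation0; exact: sx.
move=> i _; rewrite -szlenk_derivationS; apply: sx => /=.
by apply: aS; exists i; exact: ole_refl.
Qed.

End DerivationTheory.

(* Main.v *)
Require Import Defs.
From mathcomp Require Import all_boot all_order all_algebra.
From mathcomp Require Import all_classical all_reals all_analysis.
From mathcomp Require Import ring lra.

(** Since [S_Z(X) > omega], for some [e > 0] every finite Szlenk derivation of
    the dual ball [B] is nonempty.  A point [f] of a derivation is a weak* limit
    of points [g] of the previous one with [||g - f|| > e / 2], and such a [g]
    can be taken so close to [f] that [g - f] is still large at some point of
    the sphere of a prescribed [Y] of finite codimension
    ([szlenk_step_branch]).  The reason is that the unit ball is totally bounded
    modulo [Y] ([cof_tot_bounded]).  Iterating along the game of the asymptotic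
    structure, and letting the vectors chosen later lie in the kernels of the
    increments [g - f] chosen earlier, one obtains [f] and [h] in [B] with
    [(h - f) x_i >= e / 24] for all [i] ([szlenk_tree]).  As [||h - f|| <= 2],
    this gives [||sum a_i x_i|| >= (e / 48) sum a_i] for nonnegative [a_i], and
    unconditionality removes the sign restriction.  So [l_1^n] is, with one
    constant for all [n], dominated by some [(x_i)] in the game.

    The constant is then improved to any [rho < 1] by James' blocking argument
    ([james_asymptotic_l1]).  Let [th] be nearly the supremum of the constants
    with which the lower [l_1] estimate can be forced in games of every length.
    The constant [th / rho], above that supremum, fails in a game of some length
    [N], so that the other player can force [N] vectors to have a combination
    of norm [1] whose coefficients have [l_1] norm above [rho / th].  Playing
    [m] such blocks while maintaining the lower estimate with constant [th] yields
    [m] vectors with lower [l_1] estimate [th * (rho / th) = rho]. *)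

Set Implicit Arguments.
Unset Strict Implicit.
Unset Printing Implicit Defensive.
Import Order.TTheory GRing.Theory Num.Theory.
Import numFieldNormedType.Exports.
Local Open Scope classical_set_scope.
Local Open Scope ring_scope.

(** * Functionals in the dual space *)

Section DualTheory.
Variables (R : realType) (X : normedModType R).
Implicit Types (f g : X -> R).

Lemma dualD f x y : dual f -> f (x + y) = f x + f y.
Proof. by move=> [lf _]; have := lf 1 x y; rewrite scale1r mul1r. Qed.

Lemma dual0 f : dual f -> f 0 = 0.
Proof. by move=> [lf _]; have := lf (-1) 0 0; rewrite scaler0 addr0 mulN1r addNr. Qed.

Lemma dualZ f (a : R) x : dual f -> f (a *: x) = a * f x.
Proof. by move=> df; case: (df) => [lf _]; have := lf a x 0; rewrite !addr0 dual0 // addr0. Qed.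

Lemma dualB_dual f g : dual f -> dual g -> dual (f \- g).
Proof.
move=> [lf cf] [lg cg]; split=> [a x y|x]; last by apply: cvgB; [exact: cf|exact: cg].
by rewrite /= lf lg mulrBr opprD addrACA.
Qed.

Lemma dual_bounded f : dual f -> has_ubound [set `|f x| | x in [set x | `|x| <= 1]].
Proof.
move=> df; have [_ /(_ 0)] := df; rewrite /continuous_at dual0 // => /cvgr0Pnorm_lt /(_ 1 ltr01).
move=> /nbhs_ballP[r /= r0 hr]; exists (2 / r) => _ [x /= x1 <-].
have r2 : 0 < r / 2 by rewrite divr_gt0.
have : `|f ((r / 2) *: x)| < 1.
  apply: hr; rewrite -ball_normE /ball_ /= sub0r normrN normrZ gtr0_norm //.
  by apply: le_lt_trans (ler_wpM2l (ltW r2) x1) _; rewrite mulr1 ltr_pdivrMr // ltr_pMr // ltr1n.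
rewrite dualZ // normrM gtr0_norm // => /ltW.
by rewrite mulrC -ler_pdivlMr // invf_div mul1r.
Qed.

Lemma dual_ball_le f x : dual_ball f -> `|f x| <= `|x|.
Proof.
move=> [df f1]; have [->|x0] := eqVneq x 0; first by rewrite dual0 // !normr0.
have nx0 : 0 < `|x| by rewrite normr_gt0.
have : `|f (`|x|^-1 *: x)| <= 1.
  apply: le_trans f1; apply: ub_le_sup; first exact: dual_bounded.
  exists (`|x|^-1 *: x) => //=.
  by rewrite normrZ normfV normr_id mulVf // gt_eqF.
by rewrite dualZ // normrM normfV normr_id ler_pdivrMl // mulr1.
Qed.

End DualTheory.

(** * Subspaces of finite codimension *)

Section Cof.
Variables (R : realType) (X : normedModType R).
Implicit Types (Y Z W : set X).

Definition subspace Y : Prop :=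
  Y 0 /\ forall (a : R) x y, Y x -> Y y -> Y (a *: x + y).

Lemma subspaceZ Y (a : R) x : subspace Y -> Y x -> Y (a *: x).
Proof. by move=> [Y0 h] Yx; rewrite -[_ *: _]addr0; exact: h. Qed.

Lemma subspaceD Y x y : subspace Y -> Y x -> Y y -> Y (x + y).
Proof. by move=> [Y0 h] Yx Yy; rewrite -[x]scale1r; exact: h. Qed.

Lemma subspaceB Y x y : subspace Y -> Y x -> Y y -> Y (x - y).
Proof.
by move=> sY Yx Yy; apply: subspaceD => //; rewrite -scaleN1r; exact: subspaceZ.
Qed.

Definition adjoin Y (v : X) : set X := [set x | exists c : R, Y (x - c *: v)].

Lemma subspace_adjoin Y v : subspace Y -> subspace (adjoin Y v).
Proof.
move=> sY; split; first by exists 0; rewrite scale0r subr0; case: sY.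
move=> a x y [c Yc] [d Yd]; exists (a * c + d).
have -> : a *: x + y - (a * c + d) *: v = a *: (x - c *: v) + (y - d *: v).
  by rewrite scalerDl scalerBr scalerA opprD addrACA.
by case: sY => _; apply.
Qed.

Local Notation adjoin_seq := (foldr (fun v Z => adjoin Z v)).

Definition spans_mod Y W (vs : seq X) : Prop := W `<=` adjoin_seq Y vs.

Lemma adjoin_seqS Y Z vs : Y `<=` Z -> adjoin_seq Y vs `<=` adjoin_seq Z vs.
Proof.
by move=> YZ; elim: vs => [|v vs IH] x //=; [exact: YZ|move=> [c /IH]; exists c].
Qed.

Lemma foldr_adjoin_tuple Y (vs : seq X) x : adjoin_seq Y vs x ->
  exists c : 'I_(size vs) -> R, Y (x - \sum_(i < size vs) c i *: vs`_i).
Proof.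
elim: vs x => [|v vs IH] x /=; first by exists (fun=> 0); rewrite big_ord0 subr0.
move=> [c /IH[d Yd]]; exists (fun i => if unlift ord0 i is Some j then d j else c).
rewrite big_ord_recl unlift_none /= opprD addrA.
by under eq_bigr do rewrite liftK.
Qed.

Lemma tuple_foldr_adjoin Y m (v : 'I_m -> X) x (c : 'I_m -> R) :
  Y (x - \sum_(i < m) c i *: v i) ->
  adjoin_seq Y [seq v i | i <- enum 'I_m] x.
Proof.
elim: m v x c => [|m IH] v x c; first by rewrite big_ord0 subr0 enum_ord0.
rewrite big_ord_recl enum_ordSl /= opprD addrA -map_comp => h.
by exists (c ord0); exact: IH h.
Qed.

Lemma cofP Y : cof Y <->
  [/\ closed Y, subspace Y & exists vs, spans_mod Y setT vs].
Proof.
split=> [[cY sY [m [v h]]]|[cY sY [vs h]]]; split=> //.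
  exists [seq v i | i <- enum 'I_m] => x _; have [c] := h x.
  exact: tuple_foldr_adjoin.
exists (size vs), (fun i => vs`_i) => x.
by have [//|c] := @foldr_adjoin_tuple Y vs x; [exact: h|exists c].
Qed.

Lemma subspace_foldr_adjoin Y vs :
  subspace Y -> subspace (adjoin_seq Y vs).
Proof. by move=> sY; elim: vs => //= v vs; exact: subspace_adjoin. Qed.

(** Modulo [Y], this says that a subspace of a finitely generated space is
    finitely generated.  With [Y'] the span of [Y] and the tail [vs], either
    [W] lies in [Y'], or any [u] in [W] outside [Y'] can replace [v]. *)
Lemma spans_mod_sub Y W vs : subspace Y -> subspace W -> spans_mod Y W vs ->
  exists us, spans_mod (W `&` Y) W us.
Proof.
move=> sY; elim: vs W => [|v vs IH] W sW /= WY.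
  by exists [::] => x Wx; split => //; exact: WY.
have sY' := subspace_foldr_adjoin vs sY.
set Y' := adjoin_seq _ _ in WY sY'.
have [WY'|/existsNP[u /not_implyP[Wu nu]]] := pselect (W `<=` Y').
  exact: IH WY'.
have sW' : subspace (W `&` Y').
  split; first by split; [case: sW|case: sY'].
  by move=> a x y [? ?] [? ?]; split; [case: sW => _|case: sY' => _]; apply.
have [us hus] : exists us, spans_mod (W `&` Y' `&` Y) (W `&` Y') us.
  by apply: IH => // x [].
have [c hc] := WY _ Wu.
have c0 : c != 0.
  by apply/eqP => c0; move: hc; rewrite c0 scale0r subr0.
exists (u :: us) => x Wx /=; have [d hd] := WY _ Wx.
exists (d / c); apply: (@adjoin_seqS (W `&` Y' `&` Y)); first by move=> y [[? _] ?].
apply: hus; split; first by apply: subspaceB => //; exact: subspaceZ.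
have -> : x - (d / c) *: u = (x - d *: v) - (d / c) *: (u - c *: v).
  by rewrite scalerBr scalerA divfK // opprB addrA subrK.
by apply: subspaceB => //; exact: subspaceZ.
Qed.

Lemma cofT : cof [set: X].
Proof. by apply/cofP; split; [exact: closedT|split|exists [::]]. Qed.

Lemma cofI Y Z : cof Y -> cof Z -> cof (Y `&` Z).
Proof.
move=> /cofP[cY sY [vs hv]] /cofP[cZ sZ [ws hw]]; apply/cofP; split.
- exact: closedI.
- split; first by split; [case: sY|case: sZ].
  by move=> a x y [? ?] [? ?]; split; [case: sY => _|case: sZ => _]; apply.
- have [us hu] : exists us, spans_mod (Y `&` Z) Y us.
    by apply: (@spans_mod_sub Z Y ws) => // x _; exact: hw.
  exists (vs ++ us) => x _; rewrite foldr_cat.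
  exact: (adjoin_seqS hu (hv x Logic.I)).
Qed.

Lemma cof_ker (f : X -> R) : dual f -> cof [set x | f x = 0].
Proof.
move=> df; have f0 := dual0 df; have [lf cf] := df.
apply/cofP; split.
- rewrite (_ : [set x | _] = f @^-1` [set 0]) //.
  apply: closed_comp => [x _|]; first exact: cf.
  exact: closed_eq.
- by split=> // a x y /= fx fy; rewrite lf fx fy mulr0 addr0.
- have [h|/existsNP[v /eqP fv]] := pselect (forall v, f v = 0).
    by exists [::] => x _; exact: h.
  exists [:: v] => x _; exists (f x / f v) => /=.
  rewrite addrC -scaleNr lf mulNr divfK //; exact: addNr.
Qed.

End Cof.

(** * Games on subspaces of finite codimension *)

Section Games.
Variables (R : realType) (X : normedModType R).
Implicit Types (P Q : seq X -> Prop) (Y Z : set X).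

Lemma all_cof_ex_mono n P Q : (forall s, P s -> Q s) ->
  all_cof_ex n P -> all_cof_ex n Q.
Proof.
elim: n P Q => [|n IH] P Q PQ /=; first exact: PQ.
by move=> h Y /h[x Yx hx]; exists x => //; apply: IH hx => s; exact: PQ.
Qed.

Lemma ex_cof_all_mono n P Q : (forall s, P s -> Q s) ->
  ex_cof_all n P -> ex_cof_all n Q.
Proof.
elim: n P Q => [|n IH] P Q PQ /=; first exact: PQ.
by move=> [Y cY h]; exists Y => // x /h; apply: IH => s; exact: PQ.
Qed.

(** The subspaces played may be replaced by their intersections with [Z]. *)
Lemma all_cof_ex_restrict n P Z : cof Z -> all_cof_ex n P ->
  all_cof_ex n (fun s => [/\ P s, size s = n & forall x, x \in s -> sphere Z x]).
Proof.
move=> cZ; elim: n P => [|n IH] P /=; first by move=> ?; split.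
move=> h Y /cofI /(_ cZ) /h[x [[Yx Zx] x1] /IH hx]; exists x => //.
apply: all_cof_ex_mono hx => s [Ps ss hs]; split => //=; first by rewrite ss.
by move=> y; rewrite inE => /predU1P[->//|]; exact: hs.
Qed.

(** Play one strategy against the other, the subspaces being intersected. *)
Lemma all_cof_ex_and n P Q : all_cof_ex n P -> ex_cof_all n Q ->
  all_cof_ex n (fun s => P s /\ Q s).
Proof.
elim: n P Q => [|n IH] P Q //= h [Z cZ hZ] Y /cofI /(_ cZ) /h[x [[Yx Zx] x1] hx].
by exists x => //; apply: IH hx _; apply: hZ.
Qed.

Lemma all_cof_ex_witness n P : all_cof_ex n P -> exists s, P s.
Proof.
elim: n P => [|n IH] P /=; first by exists [::].
by move=> /(_ _ (@cofT _ _))[x _ /IH[s Ps]]; exists (x :: s).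
Qed.

Lemma all_cof_exN n P : ~ all_cof_ex n P -> ex_cof_all n (fun s => ~ P s).
Proof.
elim: n P => [|n IH] P //= /existsNP[Y /not_implyP[cY h]].
by exists Y => // x Yx; apply: IH => hx; apply: h; exists x.
Qed.

Lemma all_cof_ex_cat m n P : all_cof_ex (m + n) P ->
  all_cof_ex m (fun s => all_cof_ex n (fun t => P (s ++ t))).
Proof.
elim: m P => [|m IH] P //= h Y /h[x Yx hx]; exists x => //; exact: IH hx.
Qed.

End Games.

(** * Blocking and lower estimates by the norm of l_1 *)

Section Blocks.
Variables (R : realType) (X : normedModType R).
Implicit Types (s t ws : seq X) (a b : seq R).

Definition lincomb a s : X := \sum_(p <- zip a s) p.1 *: p.2.
Definition l1norm a : R := \sum_(c <- a) `|c|.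

Lemma lincomb_cat a b s t : size a = size s ->
  lincomb (a ++ b) (s ++ t) = lincomb a s + lincomb b t.
Proof. by move=> h; rewrite /lincomb zip_cat // big_cat. Qed.

Lemma lincombZ (c : R) a s : lincomb [seq c * d | d <- a] s = c *: lincomb a s.
Proof.
rewrite /lincomb; elim: a s => [|d a IH] [|x s] /=; rewrite ?big_nil ?scaler0 //.
by rewrite !big_cons /= IH scalerDr scalerA.
Qed.

Lemma l1normZ (c : R) a : l1norm [seq c * d | d <- a] = `|c| * l1norm a.
Proof.
by rewrite /l1norm big_map mulr_sumr; apply: eq_bigr => d _; rewrite normrM.
Qed.

Lemma l1norm_cat a b : l1norm (a ++ b) = l1norm a + l1norm b.
Proof. exact: big_cat. Qed.

Lemma l1norm_ge0 a : 0 <= l1norm a.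
Proof. by apply: sumr_ge0 => c _; exact: normr_ge0. Qed.

Lemma norm_lincomb_le a s : size a = size s ->
  (forall x, x \in s -> `|x| = 1) -> `|lincomb a s| <= l1norm a.
Proof.
rewrite /lincomb /l1norm; elim: a s => [|c a IH] [|x s] //=.
  by rewrite !big_nil normr0.
move=> [sz] h; rewrite !big_cons /=; apply: le_trans (ler_normD _ _) _.
rewrite normrZ (h x (mem_head _ _)) mulr1 lerD2l; apply: IH => // y ys.
by apply: h; rewrite inE ys orbT.
Qed.

Lemma lincombE n (a : 'I_n -> R) s : size s = n ->
  lincomb [seq a i | i <- enum 'I_n] s = \sum_(i < n) a i *: s`_i.
Proof.
rewrite /lincomb; elim: n a s => [|n IH] a [|x s] //=.
  by rewrite enum_ord0 big_nil big_ord0.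
by move=> [/IH h]; rewrite enum_ordSl /= big_cons big_ord_recl -map_comp h.
Qed.

Lemma l1normE n (a : 'I_n -> R) :
  l1norm [seq a i | i <- enum 'I_n] = \sum_(i < n) `|a i|.
Proof. by rewrite /l1norm big_map big_enum. Qed.

Definition lower_l1 (th : R) s : Prop :=
  forall a, size a = size s -> th * l1norm a <= `|lincomb a s|.

Lemma lower_l1_suffix th s t : lower_l1 th (s ++ t) -> lower_l1 th t.
Proof.
move=> h a sz; have := h (nseq (size s) 0 ++ a).
rewrite !size_cat size_nseq sz => /(_ erefl).
rewrite lincomb_cat ?size_nseq // l1norm_cat.
have -> : nseq (size s) (0 : R) = [seq 0 * d | d <- nseq (size s) 0].
  by rewrite map_nseq mul0r.
by rewrite lincombZ l1normZ scale0r normr0 mul0r !add0r.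
Qed.

Lemma lower_l1_prefix th s t : lower_l1 th (s ++ t) -> lower_l1 th s.
Proof.
move=> h a sz; have := h (a ++ nseq (size t) 0).
rewrite !size_cat size_nseq sz => /(_ erefl).
rewrite lincomb_cat ?size_nseq // l1norm_cat.
have -> : nseq (size t) (0 : R) = [seq 0 * d | d <- nseq (size t) 0].
  by rewrite map_nseq mul0r.
by rewrite lincombZ l1normZ scale0r normr0 mul0r !addr0.
Qed.

(** Holds when the vectors of [ws] are combinations of successive blocks of
    [t] with coefficients of [l1] norm at least [1 / th].  Only this consequence
    for the combinations of [ws] is recorded, which spares naming the blocks. *)
Definition blocked (th : R) ws t : Prop :=
  forall b, size b = size ws ->
    exists a, [/\ size a = size t, lincomb a t = lincomb b ws & l1norm b <= th * l1norm a].

(** One move [w] of the new game is the normalised value of a whole round of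
    [N] moves of the old one, in which the opponent restricts to the subspace
    to which [w] has to belong, and otherwise follows the strategy [QN]
    that makes some combination of the round short.  The lower estimate with
    constant [th1 > 0] keeps that combination nonzero. *)
Lemma all_cof_ex_blocked (th1 th2 : R) (N m : nat) (P : seq X -> Prop) :
  0 < th1 ->
  ex_cof_all N (fun s => exists a, size a = size s /\ `|lincomb a s| < th2 * l1norm a) ->
  (forall s, P s -> lower_l1 th1 s) ->
  all_cof_ex (m * N) P ->
  all_cof_ex m (fun ws => exists t, P t /\ blocked th2 ws t).
Proof.
move=> th10 QN; elim: m P => [|m IH] P PL.
  rewrite mul0n /= => P0; exists [::]; split => // b sb; exists [::].
  by case: b sb => // _; rewrite /lincomb /l1norm !big_nil mulr0.
rewrite mulSn => /all_cof_ex_cat /all_cof_ex_and /(_ QN) h /= Y cY.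
have /cofP[_ sY _] := cY.
have [s [[hs [a [sa aQ]]] ss sph]] := all_cof_ex_witness (all_cof_ex_restrict cY h).
set u := lincomb a s in aQ.
have [t Pst] := all_cof_ex_witness hs.
have a0 : 0 < l1norm a.
  rewrite lt_neqAle l1norm_ge0 andbT; apply/eqP => a0.
  by move: aQ; rewrite -a0 mulr0 ltNge normr_ge0.
have u0 : 0 < `|u|.
  apply: lt_le_trans (lower_l1_prefix (PL _ Pst) sa); exact: mulr_gt0.
have Yu : Y u.
  rewrite /u /lincomb; elim: (a) (s) sph => [|c a' IHa] [|x s'] /= sph.
  1-3: by rewrite big_nil; case: sY.
  rewrite big_cons /=; case: (sY) => _; apply.
    by have [] := sph x (mem_head _ _).
  by apply: IHa => y ys; apply: sph; rewrite inE ys orbT.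
exists (`|u|^-1 *: u).
  split; first exact: subspaceZ.
  by rewrite normrZ normfV normr_id mulVf // gt_eqF.
have := IH _ (fun t0 Pt0 => lower_l1_suffix (PL _ Pt0)) hs.
apply: all_cof_ex_mono => ws [r [Pr hr]]; exists (s ++ r); split => //.
move=> [//|b0 b] /= [/hr[a' [sa' la' na']]].
exists ([seq (b0 / `|u|) * d | d <- a] ++ a'); split.
- by rewrite !size_cat size_map sa sa'.
- rewrite lincomb_cat ?size_map // lincombZ la' /lincomb /= big_cons /=.
  by rewrite scalerA.
- have -> : l1norm (b0 :: b) = `|b0| + l1norm b by exact: big_cons.
  rewrite l1norm_cat l1normZ mulrDr lerD // normrM normfV normr_id.
  rewrite mulrCA -mulrA ler_peMr //.
  by rewrite mulrC ler_pdivlMr // mul1r mulrC ltW // mulrC.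
Qed.

End Blocks.

Section James.
Variables (R : realType) (X : normedModType R).

(** James' distortion argument.  Take [th1] in [A] with [rho * sup A < th1]:
    then [th1 / rho] is above [sup A], hence not forceable for some length [N],
    and blocking a game of length [m * N] gains the factor [rho / th1]. *)
Lemma james_asymptotic_l1 (th0 : R) : 0 < th0 ->
  (forall n, all_cof_ex n (@lower_l1 R X th0)) ->
  forall rho : R, 0 < rho < 1 -> forall m, all_cof_ex m (@lower_l1 R X rho).
Proof.
move=> th00 h0 rho /andP[rho0 rho1] m.
pose A := [set th | forall n, all_cof_ex n (@lower_l1 R X th)].
have Aub : ubound A 1.
  move=> th /(_ 1%N) /= /(_ _ (@cofT _ _))[x [_ x1]] /(_ [:: 1] erefl).
  by rewrite /l1norm /lincomb /= !big_seq1 /= scale1r x1 normr1 mulr1.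
have hsA : has_sup A by split; [exists th0|exists 1].
have supA : th0 <= sup A by apply: ub_le_sup => //; case: hsA.
have sup0 : 0 < sup A := lt_le_trans th00 supA.
have [th1 Ath1 hth1] : exists2 th1, A th1 & rho * sup A < th1.
  by apply: sup_gt; [exists th0|rewrite gtr_pMl].
have th10 : 0 < th1 by apply: lt_trans hth1; exact: mulr_gt0.
have [N hN] : exists N, ~ all_cof_ex N (@lower_l1 R X (th1 / rho)).
  apply/existsNP => hA.
  have : th1 / rho <= sup A by apply: ub_le_sup => //; case: hsA.
  by rewrite ler_pdivrMr // leNgt mulrC hth1.
have hN' : ex_cof_all N (fun s : seq X =>
    exists a, size a = size s /\ `|lincomb a s| < th1 / rho * l1norm a).
  apply: ex_cof_all_mono (all_cof_exN hN) => s /existsNP[a /not_implyP[sa /negP]].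
  by rewrite -ltNge; exists a.
have := all_cof_ex_blocked th10 hN' (fun s ls => ls) (Ath1 (m * N)%N).
apply: all_cof_ex_mono => ws [t [lt bl]] b /bl[a [sa <- nb]].
apply: le_trans (lt a sa).
by rewrite -ler_pdivlMl // mulrA [rho^-1 * _]mulrC.
Qed.

End James.

(** * Total boundedness of the ball modulo a subspace of finite codimension *)

Section FiniteCodimension.
Variables (R : realType) (X : normedModType R).
Implicit Types (Y : set X).

Lemma closed_dist Y p : closed Y ->
  (forall d : R, 0 < d -> exists2 y, Y y & `|p - y| < d) -> Y p.
Proof.
move=> cY h; apply: cY => B /nbhs_ballP[d /= d0 dB].
have [y Yy py] := h d d0; exists y; split => //; apply: dB.
by rewrite -ball_normE.
Qed.

Lemma dist_gt0 Y v : closed Y -> ~ Y v ->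
  exists2 d : R, 0 < d & forall y, Y y -> d <= `|v - y|.
Proof.
move=> cY nYv; apply: contrapT => h; apply: nYv; apply: closed_dist => // d d0.
apply: contrapT => h'; apply: h; exists d => // y Yy.
by rewrite leNgt; apply/negP => vy; apply: h'; exists y.
Qed.

Lemma adjoin_coef_le Y v (d : R) y c : subspace Y -> 0 < d ->
  (forall y, Y y -> d <= `|v - y|) -> Y y -> `|c| * d <= `|y + c *: v|.
Proof.
move=> sY d0 hd Yy; have [->|c0] := eqVneq c 0; first by rewrite normr0 mul0r.
have -> : y + c *: v = c *: (v - (- c^-1) *: y).
  by rewrite scalerBr scalerA mulrN divff // scaleN1r opprK addrC.
by rewrite normrZ ler_pM2l ?normr_gt0 //; apply: hd; exact: subspaceZ.
Qed.

(** If [y + c v] and [y' + c' v] approximate [p] up to [e] and [e'], then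
    [|c - c'| <= (e + e') / d], where [d > 0] is a lower bound for the distance
    of [v], outside [Y], to [Y].  The coefficients therefore converge, to the
    supremum of their lower bounds [c - e / d], and [p - (sup A) v] is in the
    closed set [Y]. *)
Lemma closed_adjoin Y v : closed Y -> subspace Y -> closed (adjoin Y v).
Proof.
move=> cY sY p hp; have [Yv|nYv] := pselect (Y v).
  exists 0; rewrite scale0r subr0; apply: closed_dist => // d d0.
  have [y [[c Yc] py]] := hp _ (nbhsx_ballx p d d0).
  exists y; last by move: py; rewrite -ball_normE.
  by rewrite -(subrK (c *: v) y); apply: subspaceD => //; exact: subspaceZ.
have [d d0 hd] := dist_gt0 cY nYv.
have approx e : 0 < e -> exists c y, Y y /\ `|p - (y + c *: v)| < e.
  move=> e0; have [y [[c Yc] py]] := hp _ (nbhsx_ballx p e e0).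
  exists c, (y - c *: v); split => //; move: py; rewrite -ball_normE /ball_ /=.
  by rewrite subrK.
have close e e' c c' y y' : Y y -> Y y' -> `|p - (y + c *: v)| < e ->
    `|p - (y' + c' *: v)| < e' -> c - e / d <= c' + e' / d.
  move=> Yy Yy' pe pe'.
  have : `|c - c'| * d <= e + e'.
    apply: le_trans (adjoin_coef_le (c - c') sY d0 hd (subspaceB sY Yy Yy')) _.
    have -> : y - y' + (c - c') *: v = (p - (y' + c' *: v)) - (p - (y + c *: v)).
      by rewrite opprB [RHS]addrC addrA subrK scalerBl addrACA -opprD.
    apply: le_trans (ler_normB _ _) _; rewrite addrC; exact: lerD (ltW _) (ltW _).
  rewrite -ler_pdivlMr // mulrDl => h.
  by have := le_trans (ler_norm _) h; rewrite lerBlDr lerBlDr; lra.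
pose A := [set t | exists e c y, [/\ 0 < e, Y y, `|p - (y + c *: v)| < e & t = c - e / d]].
exists (sup A); apply: closed_dist => // e e0.
(* precision [e / K] makes the total error [e / K + (e / K / d) |v|] equal [e] *)
pose K := 1 + `|v| / d.
have K1 : 1 <= K by rewrite lerDl divr_ge0 // ltW.
have K0 : 0 < K := lt_le_trans ltr01 K1.
have [c [y [Yy py]]] := approx (e / K) (divr_gt0 e0 K0).
have eK0 := divr_gt0 e0 K0.
have ubA : ubound A (c + (e / K) / d).
  by move=> _ [e' [c' [y' [e'0 Yy' py' ->]]]]; apply: close py' py.
have hA : has_sup A.
  by split; [exists (c - e / K / d), (e / K), c, y|exists (c + e / K / d)].
have h1 : c - e / K / d <= sup A.
  by apply: ub_le_sup; [case: hA|exists (e / K), c, y].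
have h2 : sup A <= c + e / K / d by apply: ge_sup => //; case: hA.
exists y => //.
have -> : p - sup A *: v - y = (p - (y + c *: v)) + (c - sup A) *: v.
  by rewrite scalerBl opprD !addrA subrK addrAC.
apply: le_lt_trans (ler_normD _ _) _.
have -> : e = e / K + e / K / d * `|v|.
  by rewrite -[X in _ = X + _]mulr1 -!mulrA -!mulrDr [d^-1 * _]mulrC -/K mulVf ?mulr1 // gt_eqF.
apply: ltr_leD => //; rewrite normrZ ler_wpM2r // ler_norml; apply/andP; split; lra.
Qed.

(** The finite net is required to lie in the unit ball: then the part in [Y] of
    a vector of the ball has norm at most [2 + d], uniformly in [Y]. *)
Definition tot_bounded_mod Y : Prop := forall d : R, 0 < d ->
  exists F : seq X, (forall z, z \in F -> `|z| <= 1) /\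
    forall x, `|x| <= 1 -> exists z y, [/\ z \in F, Y y & `|x - z - y| <= d].

(** A net outside the ball is moved into it by picking, for each of its points,
    some vector of the ball near that point. *)
Lemma tot_bounded_mod_center Y : subspace Y ->
  (forall d : R, 0 < d -> exists F : seq X,
     forall x, `|x| <= 1 -> exists z y, [/\ z \in F, Y y & `|x - z - y| <= d]) ->
  tot_bounded_mod Y.
Proof.
move=> sY h d d0; have [F hF] := h (d / 2) (divr_gt0 d0 (ltr0n _ 2)).
pose near z x := `|x| <= 1 /\ exists2 y, Y y & `|x - z - y| <= d / 2.
pose rep z : X := if pselect (exists x, near z x) is left e then projT1 (cid e) else 0.
exists (map rep F); split.
  move=> _ /mapP[z _ ->]; rewrite /rep; case: pselect => [e|_]; last by rewrite normr0.
  by case: (cid e) => x [].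
move=> x x1; have [z [y [zF Yy xy]]] := hF x x1.
have [r1 [y' Yy' ry]] : near z (rep z).
  rewrite /rep; case: pselect => [e|n]; last by case: n; exists x; split => //; exists y.
  by case: (cid e).
exists (rep z), (y - y'); split; [exact: map_f|exact: subspaceB|].
have -> : x - rep z - (y - y') = (x - z - y) - (rep z - z - y').
  rewrite !opprB [y' + (z - _)]addrC !addrA [x - z - y]addrAC subrK addrAC.
  congr (_ + _); exact: addrAC.
by apply: le_trans (ler_normB _ _) _; rewrite [leRHS]splitr lerD.
Qed.

(** Modulo [Y], the remaining coefficient of [v] is bounded by [M] when [v]
    is at distance at least [d > 0] from [Y], so a finite grid approximates it. *)
Lemma tot_bounded_mod_adjoin Y v : closed Y -> subspace Y ->
  tot_bounded_mod (adjoin Y v) -> tot_bounded_mod Y.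
Proof.
move=> cY sY h; have [Yv|nYv] := pselect (Y v).
  move=> d d0; have [F [F1 hF]] := h d d0; exists F; split => // x.
  move=> /hF[z [y [zF [c Yc] xy]]].
  exists z, y; split => //.
  by rewrite -(subrK (c *: v) y); apply: subspaceD => //; exact: subspaceZ.
have [d d0 hd] := dist_gt0 cY nYv.
apply: tot_bounded_mod_center => // e e0.
have e20 : 0 < e / 2 by rewrite divr_gt0.
have [F [F1 hF]] := h _ e20.
pose M := (2 + e / 2) / d.
have v0 : 0 < `|v|.
  by rewrite normr_gt0; apply/eqP => v0; apply: nYv; rewrite v0; case: sY.
pose eta := e / 2 / `|v|.
have eta0 : 0 < eta by rewrite divr_gt0.
pose k := Num.truncn (2 * M / eta).
exists [seq z + (j%:R * eta - M) *: v | z <- F, j <- iota 0 k.+1].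
move=> x x1; have [z [y [zF [c Yc] xy]]] := hF x x1.
have cM : `|c| <= M.
  rewrite ler_pdivlMr //; apply: le_trans (adjoin_coef_le c sY d0 hd Yc) _.
  rewrite subrK -[y](subrK (x - z)) -normrN opprD opprB.
  apply: le_trans (ler_normD _ _) _; rewrite addrC; apply: lerD => //.
  rewrite normrN; apply: le_trans (ler_normB _ _) _; have := F1 _ zF; lra.
have cM0 : 0 <= (c + M) / eta.
  by rewrite divr_ge0 ?(ltW eta0) //; move: cM; rewrite ler_norml; lra.
pose j := Num.truncn ((c + M) / eta).
have /andP[j1 j2] := truncn_itv cM0.
have jk : j \in iota 0 k.+1.
  rewrite mem_iota add0n ltnS; apply: le_truncn.
  by rewrite ler_pM2r ?invr_gt0 //; move: cM; rewrite ler_norml; lra.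
exists (z + (j%:R * eta - M) *: v), (y - c *: v); split => //.
  by apply/allpairsP; exists (z, j).
have split_error (al : R) :
    x - (z + al *: v) - (y - c *: v) = (x - z - y) + (c - al) *: v.
  rewrite opprB opprD scalerBl !addrA [LHS]addrAC [x - z - _ - y]addrAC.
  exact: addrAC.
rewrite split_error.
apply: le_trans (ler_normD _ _) _; rewrite [leRHS]splitr lerD //.
rewrite normrZ -ler_pdivlMr // -/eta.
move: j1 j2; rewrite -/j ler_pdivlMr // ltr_pdivrMr // -natr1 mulrDl mul1r => j1 j2.
rewrite ler_norml; apply/andP; split; lra.
Qed.

Lemma cof_tot_bounded Y : cof Y -> tot_bounded_mod Y.
Proof.
move=> /cofP[cY sY [vs]]; elim/last_ind: vs Y cY sY => [|vs v IH] Y cY sY h.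
  move=> d d0; exists [:: 0]; split=> [z|x x1].
    by rewrite inE => /eqP ->; rewrite normr0.
  exists 0, x; split; [exact: mem_head|exact: h|].
  by rewrite subr0 subrr normr0 ltW.
apply: (@tot_bounded_mod_adjoin _ v) => //; apply: IH.
- exact: closed_adjoin.
- exact: subspace_adjoin.
- by move: h; rewrite /spans_mod foldr_rcons.
Qed.

End FiniteCodimension.

(** * Trees from the Szlenk derivations *)

Section SzlenkTree.
Variables (R : realType) (X : normedModType R).
Implicit Types (f g h : X -> R) (K : set (X -> R)) (F : seq X).

Lemma open_ptws_near F f (eta : R) : 0 < eta ->
  exists U : set {ptws X -> R}, [/\ open U, U f &
    forall g, U g -> forall z, z \in F -> `|g z - f z| <= eta].
Proof.
move=> eta0; elim: F => [|z F [U [oU Uf hU]]]; first by exists setT; split => //; exact: openT.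
pose V : set {ptws X -> R} := (fun g : {ptws X -> R} => g z) @^-1` ball (f z) eta.
exists (V `&` U); split.
- apply: openI => //; apply: open_comp; last exact: ball_open.
  by move=> g _; exact: (@proj_continuous X (fun=> R) z).
- by split => //; exact: ballxx.
- move=> g [Vg Ug] y; rewrite inE => /predU1P[->|]; last exact: hU.
  by move: Vg; rewrite /V /= /ball /= distrC => /ltW.
Qed.

(** A weak* neighbourhood of [f] in [K] has diameter above [e], so one of two
    points at distance above [e] is at distance above [e / 2] from [f]. *)
Lemma szlenk_step_far (e : R) K f F (eta : R) :
  0 < e -> 0 < eta -> K `<=` @dual R X -> szlenk_step e K f ->
  exists g, [/\ K g, forall z, z \in F -> `|g z - f z| <= eta &
    exists2 z, `|z| <= 1 & e / 2 < g z - f z].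
Proof.
move=> e0 eta0 Kd [Kf nf].
have [U [oU Uf hU]] := open_ptws_near F f eta0.
have [g1 [g2 [[K1 U1] [K2 U2] hg]]] : exists g1 g2,
    [/\ (K `&` U) g1, (K `&` U) g2 & e < dual_norm (g1 \- g2)].
  apply: contrapT => h; apply: nf; exists (K `&` U) => //; split; first by exists U.
  apply/dual_diam_le => g h' gK hK; rewrite leNgt; apply/negP => lt.
  by apply: h; exists g, h'.
have [_ [z /= z1 <-]] : exists2 y, [set `|(g1 \- g2) x| | x in [set x | `|x| <= 1]] y & e < y.
  by apply: sup_gt hg; exists `|(g1 \- g2) 0|; exists 0 => //=; rewrite normr0.
move=> ez.
have [g [Kg Ug gz]] : exists g, [/\ K g, U g & e / 2 < `|g z - f z|].
  have [h|h] := ltP (e / 2) `|g1 z - f z|; first by exists g1.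
  exists g2; split => //.
  have -> : g2 z - f z = (g1 z - f z) - (g1 z - g2 z) by ring.
  rewrite distrC; apply: lt_le_trans (lerB_dist _ _).
  move: ez => /=; lra.
exists g; split=> //; first exact: hU.
have [ge|lt] := leP 0 (g z - f z); first by exists z => //; rewrite -(ger0_norm ge).
have gfN : g (- z) - f (- z) = - (g z - f z).
  have dB := dualB_dual (Kd _ Kg) (Kd _ Kf).
  by have := dualZ (-1) z dB; rewrite scaleN1r mulN1r.
by exists (- z); [rewrite normrN|rewrite gfN -(ltr0_norm lt)].
Qed.

(** Let [z] in the ball satisfy [(g - f) z > e / 2], and write [z = u + y + r]
    with [u] in a finite net modulo [Y], [y] in [Y] and [r] small.  As [g - f]
    is small on the net by the weak* closeness of [g] to [f], it is at least
    [e / 4] at [y], whose norm is at most [3]; normalising [y] gives [e / 12]. *)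
Lemma szlenk_step_branch (e : R) K f F (eta : R) (Y : set X) :
  0 < e -> 0 < eta -> K `<=` @dual_ball R X -> szlenk_step e K f -> cof Y ->
  exists g x, [/\ K g, forall z, z \in F -> `|g z - f z| <= eta,
    sphere Y x & e / 12 <= g x - f x].
Proof.
move=> e0 eta0 Kb sf cY.
pose d := Num.min (e / 16) 1.
have d0 : 0 < d by rewrite lt_min ltr01 andbT divr_gt0.
have [G [G1 hG]] := cof_tot_bounded cY d0.
have [||g [Kg gF [z z1 gz]]] := @szlenk_step_far e K f (F ++ G) (Num.min eta (e / 8)) e0 _ _ sf.
- by rewrite lt_min eta0 divr_gt0.
- by move=> h /Kb[].
have [u [y [uG Yy zuy]]] := hG _ z1.
have Kf : K f by case: sf.
have [[dg _] [df _]] := (Kb _ Kg, Kb _ Kf).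
have dgf := dualB_dual dg df.
pose r := z - u - y.
have gr : `|(g \- f) r| <= 2 * d.
  apply: le_trans (ler_normB _ _) _; rewrite mulr_natl mulr2n.
  by apply: lerD; (apply: le_trans zuy; exact: dual_ball_le (Kb _ _)).
have gu : `|g u - f u| <= e / 8.
  by have := gF u; rewrite mem_cat uG orbT => /(_ isT); rewrite le_min => /andP[].
have gy : e / 4 <= (g \- f) y.
  have hz : (g \- f) z = (g \- f) r + (g \- f) u + (g \- f) y.
    by rewrite -!dualD // /r; congr ((g \- f) _); rewrite addrAC !subrK.
  have d16 : d <= e / 16 by rewrite ge_min lexx.
  move: gr gu hz gz; rewrite !ler_norml /=; lra.
have y3 : `|y| <= 3.
  have -> : y = z - u - r by rewrite /r opprB addrCA subrr addr0.
  apply: le_trans (ler_normB _ _) _.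
  have := ler_normB z u; have := G1 _ uG.
  have : d <= 1 by rewrite ge_min lexx orbT.
  move: zuy; rewrite -/r; lra.
have y0 : 0 < `|y|.
  rewrite normr_gt0; apply/eqP => y0; move: gy; rewrite y0 dual0 //; lra.
exists g, (`|y|^-1 *: y); split => //.
- by move=> w wF; have := gF w; rewrite mem_cat wF => /(_ isT); rewrite le_min => /andP[].
- have /cofP[_ sY _] := cY; split; first exact: subspaceZ.
  by rewrite normrZ normfV normr_id mulVf // gt_eqF.
- rewrite -[_ - _]/((g \- f) _) dualZ // ler_pdivlMl //.
  by apply: le_trans gy; have := ler_wpM2r (ltW e0) y3; lra.
Qed.

Local Notation D e n := (szlenk_derivation e (@dual_ball R X) (iter n OS O0)).

(** After the move [x] and the passage from [f] to [g], later moves [y] are made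
    in the kernel of [g - f], so that [h - f] and [h - g] agree there, while
    [h] stays so close to [g] at [x] that half of [(g - f) x >= e / 12] is
    kept.  The set [F] collects the earlier moves. *)
Lemma szlenk_tree (e : R) n f F (eta : R) : 0 < e -> 0 < eta -> D e n f ->
  all_cof_ex n (fun s => exists h, [/\ dual_ball h,
    forall z, z \in F -> `|h z - f z| <= eta &
    forall x, x \in s -> e / 24 <= h x - f x]).
Proof.
move=> e0; elim: n f F eta => [|n IH] f F eta eta0.
  rewrite szlenk_derivation0 => Bf /=; exists f; split => // z _.
  by rewrite subrr normr0 ltW.
rewrite [iter _ _ _]/= szlenk_derivationS => sf /= Y cY.
have eta20 : 0 < eta / 2 by rewrite divr_gt0.
have DB := @szlenk_derivation_sub R X e (@dual_ball R X) (iter n OS O0).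
have [g [x [Dg gF Yx gx]]] := @szlenk_step_branch e _ f F (eta / 2) Y e0 eta20 DB sf cY.
exists x => //.
have [dg _] := DB _ Dg.
have [df _] := DB _ (szlenk_step_sub sf).
have mu0 : 0 < Num.min (eta / 2) (e / 24) by rewrite lt_min eta20 divr_gt0.
have := all_cof_ex_restrict (cof_ker (dualB_dual dg df)) (IH g (x :: F) _ mu0 Dg).
apply: all_cof_ex_mono => s [[h [Bh hF hs]] _ ker]; exists h; split => //.
- move=> z zF.
  have := hF z; rewrite inE zF orbT => /(_ isT); rewrite le_min => /andP[h1 _].
  rewrite -(subrKA (g z)) [leRHS]splitr; apply: le_trans (ler_normD _ _) _.
  by apply: lerD => //; exact: gF.
- move=> y; rewrite inE => /predU1P[->|ys].
    have := hF x (mem_head _ _); rewrite le_min => /andP[_]; rewrite ler_norml; lra.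
  have [/= gy _] := ker y ys; have := hs y ys; lra.
Qed.

(** Otherwise each index [S_Z(B, e)] is finite, and [omega] bounds them all. *)
Lemma szlenk_index_gt_omega : xlt (Some Omega) (szlenk_index X) ->
  exists2 e : R, 0 < e & forall n, D e n !=set0.
Proof.
move=> gt.
pose index_le_omega (e : R) := xle (szlenk_index_at (@dual_ball R X) e) (Some Omega).
have [e [e0 he]] : exists e, 0 < e /\ ~ index_le_omega e.
  apply: contrapT => hN.
  have PO e : 0 < e -> index_le_omega e.
    by move=> e0; apply: contrapT => h; apply: hN; exists e.
  move: gt; rewrite /szlenk_index; case E: (oleast _) => [a|] /= lt.
    have [_ /(_ _ PO)] := oleast_some E; move=> /ole_gtF; exact.
  by move/oleast_none: E => /(_ Omega).
exists e => // n; apply: contrapT => /nonemptyPn D0; apply: he.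
rewrite /index_le_omega /szlenk_index_at; case E: (oleast _) => [a|] /=.
  have [_ /(_ _ D0) an] := oleast_some E.
  by apply: oltW; exists n.
by move/oleast_none: E => /(_ _ D0).
Qed.

(** Test [lincomb a s] against [h - f], where [h] and [f] are in the dual ball. *)
Lemma positive_lower_l1 (e : R) n : 0 < e -> D e n !=set0 ->
  all_cof_ex n (fun s : seq X => forall a, size a = size s ->
    (forall c, c \in a -> 0 <= c) -> e / 48 * l1norm a <= `|lincomb a s|).
Proof.
move=> e0 [f Df]; have := @szlenk_tree e n f [::] 1 e0 ltr01 Df.
have Bf := szlenk_derivation_sub Df.
apply: all_cof_ex_mono => s [h [Bh _ hs]] a sa a0.
have dB := dualB_dual Bh.1 Bf.1.
have lo : e / 24 * l1norm a <= (h \- f) (lincomb a s).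
  rewrite /l1norm /lincomb; elim: a s sa a0 hs => [|c a IH] [|x s] //= sa a0 hs.
    by rewrite !big_nil mulr0 (dual0 Bh.1) (dual0 Bf.1) subrr.
  rewrite !big_cons /=.
  have := dualD (c *: x) (\sum_(p <- zip a s) p.1 *: p.2) dB => /= ->.
  have := dualZ c x dB => /= ->; rewrite mulrDr; apply: lerD.
    by rewrite ger0_norm ?a0 ?mem_head // mulrC ler_wpM2l ?a0 ?hs ?mem_head.
  apply: IH; first by case: sa.
    by move=> d da; apply: a0; rewrite inE da orbT.
  by move=> y ys; apply: hs; rewrite inE ys orbT.
have := dual_ball_le (lincomb a s) Bh; have := dual_ball_le (lincomb a s) Bf.
rewrite !ler_norml; move: lo => /=; lra.
Qed.

(** Choose the signs that turn the coefficients into their absolute values. *)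
Lemma lower_l1_unconditional (e C : R) n s : 0 < e -> 1 <= C -> size s = n ->
  unconditional n C s ->
  (forall a, size a = size s -> (forall c, c \in a -> 0 <= c) ->
    e * l1norm a <= `|lincomb a s|) ->
  @lower_l1 R X (e / C) s.
Proof.
move=> e0 C1 ss us pos a sa; have C0 : 0 < C := lt_le_trans ltr01 C1.
pose a' (i : 'I_n) := a`_i.
have aE : a = [seq a' i | i <- enum 'I_n].
  apply: (@eq_from_nth _ 0) => [|i]; first by rewrite size_map size_enum_ord sa ss.
  rewrite sa ss => lin; rewrite (nth_map (Ordinal lin)) ?size_enum_ord //.
  by rewrite /a' nth_enum_ord.
have := pos [seq `|a' i| | i <- enum 'I_n].
rewrite size_map size_enum_ord ss => /(_ erefl).
have -> : l1norm [seq `|a' i| | i <- enum 'I_n] = l1norm a.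
  by rewrite [in RHS]aE !l1normE; apply: eq_bigr => i _; rewrite normr_id.
rewrite lincombE // [in lincomb a s]aE lincombE // => h.
rewrite mulrAC ler_pdivrMr // [leRHS]mulrC.
apply: le_trans (us a' (fun i => a' i < 0)).
under eq_bigr do rewrite -normrEsign.
by apply: h => c /mapP[i _ ->].
Qed.

End SzlenkTree.

(** * Asymptotic l_1 structure *)

Lemma ell1_sumE (R : realType) n (a : 'I_n -> R) j :
  ((\sum_(i < n) a i *: ell1_basis R i : ell1 R n) : 'rV[R]_n) ord0 j = a j.
Proof.
rewrite /ell1_basis (bigD1 j) //= !mxE summxE big1 => [|i ij].
  by rewrite !eqxx mulr1 addr0.
by rewrite !mxE eq_sym (negbTE ij) andbF mulr0.
Qed.

Lemma ell1_norm_sum (R : realType) n (a : 'I_n -> R) :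
  `|\sum_(i < n) a i *: ell1_basis R i| = \sum_(i < n) `|a i|.
Proof. by rewrite ell1_normE; apply: eq_bigr => j _; rewrite ell1_sumE. Qed.

Lemma ell1_normalized (R : realType) n : normalized_basis (@ell1_basis R n).
Proof.
split.
- move=> v; exists (fun i => (v : 'rV[R]_n) ord0 i); apply/rowP => j.
  by rewrite ell1_sumE.
- by move=> a a0 i; rewrite -ell1_sumE a0 mxE.
- move=> i; rewrite ell1_normE (bigD1 i) //= big1 => [|j ji].
    by rewrite mxE !eqxx normr1 addr0.
  by rewrite mxE (negbTE ji) andbF normr0.
Qed.

Lemma lower_l1_equivalent (R : realType) (X : normedModType R) n (eps : R) (s : seq X) :
  0 < eps -> size s = n -> (forall x, x \in s -> `|x| = 1) ->
  lower_l1 (1 + eps)^-1 s -> equivalent_to (@ell1_basis R n) (1 + eps) s.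
Proof.
move=> eps0 ss s1 lo; exists (1 + eps), 1; split; [lra|lra|lra|] => a.
rewrite ell1_norm_sum mul1r -lincombE // -l1normE.
have sa : size [seq a i | i <- enum 'I_n] = size s by rewrite size_map size_enum_ord.
by rewrite lo //= norm_lincomb_le.
Qed.

Theorem mainTheorem6 (R : realType) (X : completeNormedModType R) :
  separable_dual X ->
  unconditional_asymptotic_structure X ->
  xlt (Some Omega) (szlenk_index X) ->
  forall n : nat, (1 <= n)%N -> in_asymptotic_structure X (@ell1_basis R n).
Proof.
move=> _ [C C1 uncond] /szlenk_index_gt_omega[e e0 De] n n0.
split; first exact: ell1_normalized.
have C0 : 0 < C := lt_le_trans ltr01 C1.
have e48 : 0 < e / 48 by rewrite divr_gt0.
have th0 : 0 < e / 48 / C by rewrite divr_gt0.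
have base m : all_cof_ex m (@lower_l1 R X (e / 48 / C)).
  case: m => [|m].
    by case=> // _; rewrite /l1norm /lincomb !big_nil mulr0.
  have pos := all_cof_ex_restrict (cofT X) (positive_lower_l1 e0 (De m.+1)).
  have := all_cof_ex_and pos (uncond m.+1 isT).
  apply: all_cof_ex_mono => s [[poss ss _] us].
  exact: (@lower_l1_unconditional R X (e / 48) C m.+1 s).
move=> eps eps0.
have rho : 0 < (1 + eps)^-1 < 1 by rewrite invr_gt0 invf_lt1 ?ltrDl ?addr_gt0.
have := all_cof_ex_restrict (cofT X) (james_asymptotic_l1 th0 base rho n).
apply: all_cof_ex_mono => s [lo ss s1]; apply: lower_l1_equivalent => //.
by move=> x /s1[].
Qed.
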